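(* Let $\Sigma$ be any set of sequents in the language of $\mathbf{MPDBL}$. If an s-hypersequent $\alpha_1\vdash\beta_1\mid\dots\mid\alpha_n\vdash\beta_n$ is provable in $\mathbf{MPDBL}\Sigma$, then it is valid in the class $V_\Sigma$ of all pure double Boolean algebras with operators in which every sequent of $\Sigma$ is valid.
   Context: Pure double Boolean algebras. A double Boolean algebra is an algebra $\mathbf{D}=(D,\sqcup,\sqcap,\neg,\lrcorner,\top,\bot)$ such that, writing $x\vee y:=\neg(\neg x\sqcap\neg y)$ and $x\wedge y:=\lrcorner(\lrcorner x\sqcup\lrcorner y)$, for all $x,y,z$: $(x\sqcap x)\sqcap y=x\sqcap y$; $(x\sqcup x)\sqcup y=x\sqcup y$; $\sqcap,\sqcup$ commutative and associative; $\neg(x\sqcap x)=\neg x$; $\lrcorner(x\sqcup x)=\lrcorner x$; $x\sqcap(x\sqcup y)=x\sqcap x$; $x\sqcup(x\sqcap y)=x\sqcup x$; $x\sqcap(y\vee z)=(x\sqcap y)\vee(x\sqcap z)$; $x\sqcup(y\wedge z)=(x\sqcup y)\wedge(x\sqcup z)$; $x\sqcap(x\vee y)=x\sqcap x$; $x\sqcup(x\wedge y)=x\sqcup x$; $\neg\neg(x\sqcap y)=x\sqcap y$; $\lrcorner\lrcorner(x\sqcup y)=x\sqcup y$; $x\sqcap\neg x=\bot$; $x\sqcup\lrcorner x=\top$; $\neg\bot=\top\sqcap\top$; $\lrcorner\top=\bot\sqcup\bot$; $\neg\top=\bot$; $\lrcorner\bot=\top$; $(x\sqcap x)\sqcup(x\sqcap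 x)=(x\sqcup x)\sqcap(x\sqcup x)$. It is pure (pdBa) if each $x$ satisfies $x\sqcap x=x$ or $x\sqcup x=x$. $D_\sqcap=\{x:x\sqcap x=x\}$, $D_\sqcup=\{x:x\sqcup x=x\}$; $x\sqsubseteq y$ iff $x\sqcap y=x\sqcap x$ and $x\sqcup y=y\sqcup y$. A pdBa with operators (pdBao) is a pdBa with two maps $\mathbf{I},\mathbf{C}:D\to D$, monotone w.r.t. $\sqsubseteq$, such that $\mathbf{I}(x\sqcap y)=\mathbf{I}(x)\sqcap\mathbf{I}(y)$, $\mathbf{C}(x\sqcup y)=\mathbf{C}(x)\sqcup\mathbf{C}(y)$, $\mathbf{I}(\neg\bot)=\neg\bot$, $\mathbf{C}(\lrcorner\top)=\lrcorner\top$, $\mathbf{I}(x\sqcap x)=\mathbf{I}(x)$, $\mathbf{C}(x\sqcup x)=\mathbf{C}(x)$. The logic PDBL. Variables: object variables $\mathbf{OV}$ ($p,\dots$) and property variables $\mathbf{PV}$ ($P,\dots$), disjoint countably infinite sets; constants $\top,\bot$; connectives $\sqcap,\sqcup$ (binary), $\neg,\lrcorner$ (unary). $\alpha\vee\beta:=\neg(\neg\alpha\sqcap\neg\beta)$, $\alpha\wedge\beta:=\lrcorner(\lrcorner\alpha\sqcup\lrcorner\beta)$. Sequents $\alpha\vdash\beta$ ($\alpha\dashv\vdash\beta$ means both directions); s-hypersequents are finite sequences $\alpha_1\vdash\beta_1\mid\dots\mid\alpha_n\vdash\beta_n$; $B,C,\dots,X$ range over possibly empty s-hypersequents. Axioms: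 $\alpha\vdash\alpha$; $\alpha\sqcap\beta\vdash\alpha$; $\alpha\sqcap\beta\vdash\beta$; $\alpha\vdash\alpha\sqcup\beta$; $\beta\vdash\alpha\sqcup\beta$; $\alpha\sqcap\beta\vdash(\alpha\sqcap\beta)\sqcap(\alpha\sqcap\beta)$; $(\alpha\sqcup\beta)\sqcup(\alpha\sqcup\beta)\vdash\alpha\sqcup\beta$; $\neg(\alpha\sqcap\alpha)\vdash\neg\alpha$; $\lrcorner\alpha\vdash\lrcorner(\alpha\sqcup\alpha)$; $\alpha\sqcap\neg\alpha\vdash\bot$; $\top\vdash\alpha\sqcup\lrcorner\alpha$; $\neg\neg(\alpha\sqcap\beta)\dashv\vdash\alpha\sqcap\beta$; $\lrcorner\lrcorner(\alpha\sqcup\beta)\dashv\vdash\alpha\sqcup\beta$; $\alpha\sqcap\alpha\vdash\alpha\sqcap(\alpha\sqcup\beta)$; $\alpha\sqcup(\alpha\sqcap\beta)\vdash\alpha\sqcup\alpha$; $\alpha\sqcap\alpha\vdash\alpha\sqcap(\alpha\vee\beta)$; $\alpha\sqcup(\alpha\wedge\beta)\vdash\alpha\sqcup\alpha$; $\alpha\sqcap(\beta\vee\gamma)\dashv\vdash(\alpha\sqcap\beta)\vee(\alpha\sqcap\gamma)$; $\alpha\sqcup(\beta\wedge\gamma)\dashv\vdash(\alpha\sqcup\beta)\wedge(\alpha\sqcup\gamma)$; $\bot\vdash\alpha$; $\alpha\vdash\top$; $\neg\top\vdash\bot$; $\top\vdash\lrcorner\bot$; $\neg\bot\dashv\vdash\top\sqcap\top$;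 $\lrcorner\top\dashv\vdash\bot\sqcup\bot$; $(\alpha\sqcup\alpha)\sqcap(\alpha\sqcup\alpha)\dashv\vdash(\alpha\sqcap\alpha)\sqcup(\alpha\sqcap\alpha)$; $p\sqcap p\dashv\vdash p$ ($p\in\mathbf{OV}$); $P\sqcup P\dashv\vdash P$ ($P\in\mathbf{PV}$); (Sp) $\alpha\vdash\alpha\sqcap\alpha\mid\alpha\sqcup\alpha\vdash\alpha$. Rules: from $B\mid\alpha\vdash\beta\mid C$ infer $B\mid\alpha\sqcap\gamma\vdash\beta\sqcap\gamma\mid C$, $B\mid\gamma\sqcap\alpha\vdash\gamma\sqcap\beta\mid C$, $B\mid\alpha\sqcup\gamma\vdash\beta\sqcup\gamma\mid C$, $B\mid\gamma\sqcup\alpha\vdash\gamma\sqcup\beta\mid C$, $B\mid\neg\beta\vdash\neg\alpha\mid C$, $B\mid\lrcorner\beta\vdash\lrcorner\alpha\mid C$; from $B\mid\alpha\vdash\beta\mid C$ and $D\mid\beta\vdash\gamma\mid E$ infer $B\mid D\mid\alpha\vdash\gamma\mid C\mid E$; from $B\mid\alpha\sqcap\beta\vdash\alpha\sqcap\alpha\mid C$, $D\mid\alpha\sqcap\alpha\vdash\alpha\sqcap\beta\mid E$, $F\mid\alpha\sqcup\beta\vdash\beta\sqcup\beta\mid G$, $H\mid\beta\sqcup\beta\vdash\alpha\sqcup\beta\mid X$ infer $B\mid D\mid F\mid H\mid\alpha\vdash\beta\mid C\mid E\mid G\mid X$; external: from $B\mid D\mid D\mid C$ infer $B\mid D\mid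 C$; from $B\mid D\mid E\mid C$ infer $B\mid E\mid D\mid C$; from $B$ infer $B\mid C$. MPDBL and MPDBLΣ. $\mathbf{MPDBL}$ adds unary connectives $\square,\blacksquare$ to the language (all PDBL axiom schemes and rules now range over the enlarged set of formulae), with additional axioms $\square\alpha\sqcap\square\beta\dashv\vdash\square(\alpha\sqcap\beta)$; $\blacksquare\alpha\sqcup\blacksquare\beta\dashv\vdash\blacksquare(\alpha\sqcup\beta)$; $\square(\neg\bot)\dashv\vdash\neg\bot$; $\blacksquare(\lrcorner\top)\dashv\vdash\lrcorner\top$; $\square(\alpha\sqcap\alpha)\dashv\vdash\square\alpha$; $\blacksquare(\alpha\sqcup\alpha)\dashv\vdash\blacksquare\alpha$, and rules: from $B\mid\alpha\vdash\beta\mid C$ infer $B\mid\square\alpha\vdash\square\beta\mid C$ and $B\mid\blacksquare\alpha\vdash\blacksquare\beta\mid C$. For a set $\Sigma$ of sequents, $\mathbf{MPDBL}\Sigma$ is $\mathbf{MPDBL}$ with all sequents of $\Sigma$ added as axioms. Provability is via finite derivations. Semantics. A valuation on a pdBao is a map $v$ with $v(p)\in D_\sqcap$, $v(P)\in D_\sqcup$, $v(\top)=\top$, $v(\bot)=\bot$, extended homomorphically, with $v(\square\alpha)=\mathbf{I}(v(\alpha))$, $v(\blacksquare\alpha)=\mathbf{C}(v(\alpha))$. $v$ satisfies $\alpha\vdash\beta$ iff $v(\alpha)\sqsubseteq v(\beta)$, and an s-hypersequent iff it satisfies some component; an s-hypersequent is true in an algebra if every valuation satisfies it and valid in a class if true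 in each member. *)

(* Defs.v *)
From Stdlib Require Import List.
Export ListNotations.

Set Implicit Arguments.
Unset Strict Implicit.
Unset Printing Implicit Defensive.

Declare Scope alg_scope.
Delimit Scope alg_scope with alg.
Declare Scope form_scope.
Delimit Scope form_scope with form.

Reserved Notation "x ⊓ y" (at level 40, left associativity).
Reserved Notation "x ⊔ y" (at level 40, left associativity).
Reserved Notation "¬ x" (at level 35, right associativity).
Reserved Notation "⌟ x" (at level 35, right associativity).
Reserved Notation "x ⋎ y" (at level 40, left associativity).
Reserved Notation "x ⋏ y" (at level 40, left associativity).
Reserved Notation "x ⊑ y" (at level 70, no associativity).
Reserved Notation "x ⊢ y" (at level 70, no associativity).

Record alg := Alg {
  alg_sort :> Type;
  alg_cap : alg_sort -> alg_sort -> alg_sort;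
  alg_cup : alg_sort -> alg_sort -> alg_sort;
  alg_neg : alg_sort -> alg_sort;
  alg_opp : alg_sort -> alg_sort;
  alg_top : alg_sort;
  alg_bot : alg_sort
}.

Arguments alg_top {a}.
Arguments alg_bot {a}.

Bind Scope alg_scope with alg_sort.

Notation "x ⊓ y" := (alg_cap x y) : alg_scope.
Notation "x ⊔ y" := (alg_cup x y) : alg_scope.
Notation "¬ x" := (alg_neg x) : alg_scope.
Notation "⌟ x" := (alg_opp x) : alg_scope.
Notation "⊤" := alg_top : alg_scope.
Notation "⊥" := alg_bot : alg_scope.

Definition alg_vee (D : alg) (x y : D) : D := (¬ (¬ x ⊓ ¬ y))%alg.
Definition alg_wedge (D : alg) (x y : D) : D := (⌟ (⌟ x ⊔ ⌟ y))%alg.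

(* The derived operations are written ⋎ and ⋏, since ∨ and ∧ usually denote
   the propositional connectives. *)
Notation "x ⋎ y" := (alg_vee x y) : alg_scope.
Notation "x ⋏ y" := (alg_wedge x y) : alg_scope.

Record is_dBa (D : alg) : Prop := IsDBa {
  dba_cap_idl : forall x y : D, ((x ⊓ x) ⊓ y = x ⊓ y)%alg;
  dba_cup_idl : forall x y : D, ((x ⊔ x) ⊔ y = x ⊔ y)%alg;
  dba_capC : forall x y : D, (x ⊓ y = y ⊓ x)%alg;
  dba_cupC : forall x y : D, (x ⊔ y = y ⊔ x)%alg;
  dba_capA : forall x y z : D, (x ⊓ (y ⊓ z) = (x ⊓ y) ⊓ z)%alg;
  dba_cupA : forall x y z : D, (x ⊔ (y ⊔ z) = (x ⊔ y) ⊔ z)%alg;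
  dba_neg_cap : forall x : D, (¬ (x ⊓ x) = ¬ x)%alg;
  dba_opp_cup : forall x : D, (⌟ (x ⊔ x) = ⌟ x)%alg;
  dba_cap_cup : forall x y : D, (x ⊓ (x ⊔ y) = x ⊓ x)%alg;
  dba_cup_cap : forall x y : D, (x ⊔ (x ⊓ y) = x ⊔ x)%alg;
  dba_cap_veeD : forall x y z : D, (x ⊓ (y ⋎ z) = (x ⊓ y) ⋎ (x ⊓ z))%alg;
  dba_cup_wedgeD : forall x y z : D, (x ⊔ (y ⋏ z) = (x ⊔ y) ⋏ (x ⊔ z))%alg;
  dba_cap_vee : forall x y : D, (x ⊓ (x ⋎ y) = x ⊓ x)%alg;
  dba_cup_wedge : forall x y : D, (x ⊔ (x ⋏ y) = x ⊔ x)%alg;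
  dba_negK : forall x y : D, (¬ ¬ (x ⊓ y) = x ⊓ y)%alg;
  dba_oppK : forall x y : D, (⌟ ⌟ (x ⊔ y) = x ⊔ y)%alg;
  dba_cap_neg : forall x : D, (x ⊓ ¬ x = ⊥)%alg;
  dba_cup_opp : forall x : D, (x ⊔ ⌟ x = ⊤)%alg;
  dba_neg_bot : (¬ ⊥ = ⊤ ⊓ ⊤ :> D)%alg;
  dba_opp_top : (⌟ ⊤ = ⊥ ⊔ ⊥ :> D)%alg;
  dba_neg_top : (¬ ⊤ = ⊥ :> D)%alg;
  dba_opp_bot : (⌟ ⊥ = ⊤ :> D)%alg;
  dba_cap_cup_id : forall x : D, ((x ⊓ x) ⊔ (x ⊓ x) = (x ⊔ x) ⊓ (x ⊔ x))%alg
}.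

Definition in_cap (D : alg) (x : D) : Prop := (x ⊓ x = x)%alg.
Definition in_cup (D : alg) (x : D) : Prop := (x ⊔ x = x)%alg.

Definition pure (D : alg) : Prop := forall x : D, in_cap x \/ in_cup x.

Definition alg_le (D : alg) (x y : D) : Prop :=
  (x ⊓ y = x ⊓ x /\ x ⊔ y = y ⊔ y)%alg.

Notation "x ⊑ y" := (alg_le x y) : alg_scope.

Record pdBao := PdBao {
  pdbao_alg :> alg;
  pdbao_I : pdbao_alg -> pdbao_alg;
  pdbao_C : pdbao_alg -> pdbao_alg;
  pdbao_dBa : is_dBa pdbao_alg;
  pdbao_pure : pure pdbao_alg;
  pdbao_I_mono : forall x y, (x ⊑ y -> pdbao_I x ⊑ pdbao_I y)%alg;
  pdbao_C_mono : forall x y, (x ⊑ y -> pdbao_C x ⊑ pdbao_C y)%alg;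
  pdbao_I_cap : forall x y, (pdbao_I (x ⊓ y) = pdbao_I x ⊓ pdbao_I y)%alg;
  pdbao_C_cup : forall x y, (pdbao_C (x ⊔ y) = pdbao_C x ⊔ pdbao_C y)%alg;
  pdbao_I_neg_bot : (pdbao_I (¬ ⊥) = ¬ ⊥)%alg;
  pdbao_C_opp_top : (pdbao_C (⌟ ⊤) = ⌟ ⊤)%alg;
  pdbao_I_id : forall x, (pdbao_I (x ⊓ x) = pdbao_I x)%alg;
  pdbao_C_id : forall x, (pdbao_C (x ⊔ x) = pdbao_C x)%alg
}.

(* Each of the two disjoint countably infinite sets of variables is indexed
   by nat. *)
Inductive form : Type :=
  | OVar (i : nat)
  | PVar (i : nat)
  | FTop
  | FBot
  | FCap (a b : form)
  | FCup (a b : form)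
  | FNeg (a : form)
  | FOpp (a : form)
  | WBox (a : form)
  | BBox (a : form).

Bind Scope form_scope with form.

Notation "a ⊓ b" := (FCap a b) : form_scope.
Notation "a ⊔ b" := (FCup a b) : form_scope.
Notation "¬ a" := (FNeg a) : form_scope.
Notation "⌟ a" := (FOpp a) : form_scope.
Notation "⊤" := FTop : form_scope.
Notation "⊥" := FBot : form_scope.
Notation "□ a" := (WBox a) (at level 35, right associativity) : form_scope.
Notation "■ a" := (BBox a) (at level 35, right associativity) : form_scope.

Definition FVee (a b : form) : form := (¬ (¬ a ⊓ ¬ b))%form.
Definition FWedge (a b : form) : form := (⌟ (⌟ a ⊔ ⌟ b))%form.

Notation "a ⋎ b" := (FVee a b) : form_scope.
Notation "a ⋏ b" := (FWedge a b) : form_scope.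

Inductive sequent : Type := Sequent (a b : form).

Notation "a ⊢ b" := (Sequent a b) : form_scope.

Definition hypersequent : Type := list sequent.

Local Open Scope form_scope.

(* The axioms stated with ⊣⊢: each pair stands for both sequents. *)
Inductive biaxiom : form -> form -> Prop :=
  | bi_negK a b : biaxiom (¬ ¬ (a ⊓ b)) (a ⊓ b)
  | bi_oppK a b : biaxiom (⌟ ⌟ (a ⊔ b)) (a ⊔ b)
  | bi_cap_veeD a b c : biaxiom (a ⊓ (b ⋎ c)) ((a ⊓ b) ⋎ (a ⊓ c))
  | bi_cup_wedgeD a b c : biaxiom (a ⊔ (b ⋏ c)) ((a ⊔ b) ⋏ (a ⊔ c))
  | bi_neg_bot : biaxiom (¬ ⊥) (⊤ ⊓ ⊤)
  | bi_opp_top : biaxiom (⌟ ⊤) (⊥ ⊔ ⊥)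
  | bi_cap_cup_id a :
      biaxiom ((a ⊔ a) ⊓ (a ⊔ a)) ((a ⊓ a) ⊔ (a ⊓ a))
  | bi_OVar i : biaxiom (OVar i ⊓ OVar i) (OVar i)
  | bi_PVar i : biaxiom (PVar i ⊔ PVar i) (PVar i)
  | bi_wbox_cap a b : biaxiom (□ a ⊓ □ b) (□ (a ⊓ b))
  | bi_bbox_cup a b : biaxiom (■ a ⊔ ■ b) (■ (a ⊔ b))
  | bi_wbox_neg_bot : biaxiom (□ (¬ ⊥)) (¬ ⊥)
  | bi_bbox_opp_top : biaxiom (■ (⌟ ⊤)) (⌟ ⊤)
  | bi_wbox_id a : biaxiom (□ (a ⊓ a)) (□ a)
  | bi_bbox_id a : biaxiom (■ (a ⊔ a)) (■ a).

Inductive seq_axiom : sequent -> Prop :=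
  | ax_refl a : seq_axiom (a ⊢ a)
  | ax_capl a b : seq_axiom (a ⊓ b ⊢ a)
  | ax_capr a b : seq_axiom (a ⊓ b ⊢ b)
  | ax_cupl a b : seq_axiom (a ⊢ a ⊔ b)
  | ax_cupr a b : seq_axiom (b ⊢ a ⊔ b)
  | ax_cap_id a b : seq_axiom (a ⊓ b ⊢ (a ⊓ b) ⊓ (a ⊓ b))
  | ax_cup_id a b : seq_axiom ((a ⊔ b) ⊔ (a ⊔ b) ⊢ a ⊔ b)
  | ax_neg_cap a : seq_axiom (¬ (a ⊓ a) ⊢ ¬ a)
  | ax_opp_cup a : seq_axiom (⌟ a ⊢ ⌟ (a ⊔ a))
  | ax_cap_neg a : seq_axiom (a ⊓ ¬ a ⊢ ⊥)
  | ax_cup_opp a : seq_axiom (⊤ ⊢ a ⊔ ⌟ a)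
  | ax_cap_cup a b : seq_axiom (a ⊓ a ⊢ a ⊓ (a ⊔ b))
  | ax_cup_cap a b : seq_axiom (a ⊔ (a ⊓ b) ⊢ a ⊔ a)
  | ax_cap_vee a b : seq_axiom (a ⊓ a ⊢ a ⊓ (a ⋎ b))
  | ax_cup_wedge a b : seq_axiom (a ⊔ (a ⋏ b) ⊢ a ⊔ a)
  | ax_bot a : seq_axiom (⊥ ⊢ a)
  | ax_top a : seq_axiom (a ⊢ ⊤)
  | ax_neg_top : seq_axiom (¬ ⊤ ⊢ ⊥)
  | ax_opp_bot : seq_axiom (⊤ ⊢ ⌟ ⊥)
  | ax_bi_lr a b : biaxiom a b -> seq_axiom (a ⊢ b)
  | ax_bi_rl a b : biaxiom a b -> seq_axiom (b ⊢ a).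

(* The sequents of Sigma are added as they stand, not as schemes: they are
   not closed under substitution. *)
Inductive provable (Sigma : sequent -> Prop) : hypersequent -> Prop :=
  | pr_axiom s : seq_axiom s -> provable Sigma [s]
  | pr_Sigma s : Sigma s -> provable Sigma [s]
  | pr_Sp a : provable Sigma [a ⊢ a ⊓ a; a ⊔ a ⊢ a]
  | pr_capr B C a b c :
      provable Sigma (B ++ [a ⊢ b] ++ C) ->
      provable Sigma (B ++ [a ⊓ c ⊢ b ⊓ c] ++ C)
  | pr_capl B C a b c :
      provable Sigma (B ++ [a ⊢ b] ++ C) ->
      provable Sigma (B ++ [c ⊓ a ⊢ c ⊓ b] ++ C)
  | pr_cupr B C a b c :
      provable Sigma (B ++ [a ⊢ b] ++ C) ->
      provable Sigma (B ++ [a ⊔ c ⊢ b ⊔ c] ++ C)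
  | pr_cupl B C a b c :
      provable Sigma (B ++ [a ⊢ b] ++ C) ->
      provable Sigma (B ++ [c ⊔ a ⊢ c ⊔ b] ++ C)
  | pr_neg B C a b :
      provable Sigma (B ++ [a ⊢ b] ++ C) ->
      provable Sigma (B ++ [¬ b ⊢ ¬ a] ++ C)
  | pr_opp B C a b :
      provable Sigma (B ++ [a ⊢ b] ++ C) ->
      provable Sigma (B ++ [⌟ b ⊢ ⌟ a] ++ C)
  | pr_wbox B C a b :
      provable Sigma (B ++ [a ⊢ b] ++ C) ->
      provable Sigma (B ++ [□ a ⊢ □ b] ++ C)
  | pr_bbox B C a b :
      provable Sigma (B ++ [a ⊢ b] ++ C) ->
      provable Sigma (B ++ [■ a ⊢ ■ b] ++ C)
  | pr_cut B C D E a b c :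
      provable Sigma (B ++ [a ⊢ b] ++ C) ->
      provable Sigma (D ++ [b ⊢ c] ++ E) ->
      provable Sigma (B ++ D ++ [a ⊢ c] ++ C ++ E)
  | pr_order B C D E F G H X a b :
      provable Sigma (B ++ [a ⊓ b ⊢ a ⊓ a] ++ C) ->
      provable Sigma (D ++ [a ⊓ a ⊢ a ⊓ b] ++ E) ->
      provable Sigma (F ++ [a ⊔ b ⊢ b ⊔ b] ++ G) ->
      provable Sigma (H ++ [b ⊔ b ⊢ a ⊔ b] ++ X) ->
      provable Sigma (B ++ D ++ F ++ H ++ [a ⊢ b] ++ C ++ E ++ G ++ X)
  | pr_contraction B C D :
      provable Sigma (B ++ D ++ D ++ C) ->
      provable Sigma (B ++ D ++ C)
  | pr_exchange B C D E :
      provable Sigma (B ++ D ++ E ++ C) ->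
      provable Sigma (B ++ E ++ D ++ C)
  | pr_weakening B C :
      provable Sigma B ->
      provable Sigma (B ++ C).

(* A valuation is given by its values on the variables; [eval] is its unique
   homomorphic extension to all formulae. *)
Record valuation (D : pdBao) := Valuation {
  val_O : nat -> D;
  val_P : nat -> D;
  val_O_in_cap : forall i, in_cap (val_O i);
  val_P_in_cup : forall i, in_cup (val_P i)
}.

Fixpoint eval (D : pdBao) (v : valuation D) (a : form) : D :=
  match a with
  | OVar i => val_O v i
  | PVar i => val_P v i
  | FTop => alg_top
  | FBot => alg_bot
  | FCap a b => alg_cap (eval v a) (eval v b)
  | FCup a b => alg_cup (eval v a) (eval v b)
  | FNeg a => alg_neg (eval v a)
  | FOpp a => alg_opp (eval v a)
  | WBox a => pdbao_I (eval v a)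
  | BBox a => pdbao_C (eval v a)
  end.

Definition sat_sequent (D : pdBao) (v : valuation D) (s : sequent) : Prop :=
  match s with Sequent a b => alg_le (eval v a) (eval v b) end.

Definition sat (D : pdBao) (v : valuation D) (G : hypersequent) : Prop :=
  Exists (sat_sequent v) G.

Definition true_in (D : pdBao) (G : hypersequent) : Prop :=
  forall v : valuation D, sat v G.

Definition valid_in (K : pdBao -> Prop) (G : hypersequent) : Prop :=
  forall D : pdBao, K D -> true_in D G.

Definition V (Sigma : sequent -> Prop) (D : pdBao) : Prop :=
  forall s : sequent, Sigma s -> true_in D [s].

(* Main.v *)
(** Soundness by induction on derivations.  If [x] is [⊓]-idempotent, then
    [x ⊑ y] reduces to [x ⊓ y = x], since absorption then gives the condition on
    [⊔]; hence [⊑] is antisymmetric on the values of [⊓] and [¬].  The facts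
    about [⊔] and [⌟] are those about [⊓] and [¬] read in the dual algebra.
    Purity is what makes [(Sp)] sound. *)

From Stdlib Require Import List.
Require Import Defs.

Set Implicit Arguments.
Unset Strict Implicit.
Unset Printing Implicit Defensive.

(** * Meets, negation and the order in a double Boolean algebra *)

Section CapHalf.

Variables (D : alg) (hD : is_dBa D).
Implicit Types x y z : D.
Local Open Scope alg_scope.

Lemma le_refl x : x ⊑ x.
Proof. split; reflexivity. Qed.

Lemma eq_le x y : x = y -> x ⊑ y.
Proof. intros ->; apply le_refl. Qed.

Lemma cap_idr x y : x ⊓ (y ⊓ y) = x ⊓ y.
Proof. now rewrite (dba_capC hD), (dba_cap_idl hD), (dba_capC hD). Qed.

Lemma cap_capl x y : (x ⊓ y) ⊓ x = x ⊓ y.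
Proof. now rewrite (dba_capC hD), (dba_capA hD), (dba_cap_idl hD). Qed.

Lemma cap_capr x y : (x ⊓ y) ⊓ y = x ⊓ y.
Proof. now rewrite <- (dba_capA hD), cap_idr. Qed.

Lemma cap_in_cap x y : in_cap (x ⊓ y).
Proof. unfold in_cap; now rewrite (dba_capA hD), cap_capl, cap_capr. Qed.

Lemma negnegE x : ¬ ¬ x = x ⊓ x.
Proof. now rewrite <- (dba_neg_cap hD x), (dba_negK hD). Qed.

(** Triple negation: [¬ x ⊓ ¬ x = ¬ ¬ ¬ x = ¬ (x ⊓ x) = ¬ x]. *)
Lemma neg_in_cap x : in_cap (¬ x).
Proof. unfold in_cap; now rewrite <- negnegE, (negnegE x), (dba_neg_cap hD). Qed.

Lemma neg_capE x y : ¬ (x ⊓ y) = ¬ x ⋎ ¬ y.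
Proof. unfold alg_vee; now rewrite !negnegE, (dba_cap_idl hD), cap_idr. Qed.

Lemma cap_eq_le x y : x ⊓ y = x -> x ⊑ y.
Proof.
intros e; split.
- rewrite e; rewrite <- e; symmetry; apply cap_in_cap.
- rewrite <- e at 1.
  now rewrite (dba_cupC hD), (dba_capC hD), (dba_cup_cap hD).
Qed.

Lemma le_in_cap_antisym x y : in_cap x -> in_cap y -> x ⊑ y -> y ⊑ x -> x = y.
Proof.
intros hx hy [e _] [e' _].
now rewrite <- hx, <- e, (dba_capC hD), e', hy.
Qed.

Lemma cap_lel x y : x ⊓ y ⊑ x.
Proof. apply cap_eq_le, cap_capl. Qed.

Lemma cap_ler x y : x ⊓ y ⊑ y.
Proof. apply cap_eq_le, cap_capr. Qed.

(** The [⊓] half of transitivity, kept apart so that its dual supplies the [⊔] half. *)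
Lemma le_cap_trans x y z : x ⊓ y = x ⊓ x -> y ⊓ z = y ⊓ y -> x ⊓ z = x ⊓ x.
Proof.
intros e e'.
now rewrite <- (dba_cap_idl hD), <- e, <- (dba_capA hD), e', cap_idr.
Qed.

Lemma le_cap2r x y z : x ⊑ y -> x ⊓ z ⊑ y ⊓ z.
Proof.
intros [e _]; apply cap_eq_le.
rewrite (dba_capC hD y z), (dba_capA hD), cap_capr, (dba_capC hD x z).
now rewrite <- (dba_capA hD), e, cap_idr.
Qed.

Lemma le_cap2l x y z : x ⊑ y -> z ⊓ x ⊑ z ⊓ y.
Proof. rewrite !(dba_capC hD z); apply le_cap2r. Qed.

(** De Morgan gives [¬ x = ¬ (x ⊓ x) = ¬ (y ⊓ x) = ¬ y ⋎ ¬ x], and absorption then yields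
    [¬ y ⊓ ¬ x = ¬ y ⊓ ¬ y = ¬ y]. *)
Lemma le_neg x y : x ⊑ y -> ¬ y ⊑ ¬ x.
Proof.
intros [e _]; apply cap_eq_le.
rewrite <- (dba_neg_cap hD x), <- e, (dba_capC hD), (dba_capC hD x y), neg_capE.
rewrite (dba_capC hD), (dba_cap_vee hD); apply neg_in_cap.
Qed.

Lemma bot_le x : ⊥ ⊑ x.
Proof.
apply cap_eq_le.
now rewrite <- (dba_cap_neg hD x), cap_capl.
Qed.

End CapHalf.

(** * Duality, and the facts about joins that it yields *)

Definition dual_alg (D : alg) : alg :=
  @Alg D (@alg_cup D) (@alg_cap D) (@alg_opp D) (@alg_neg D) alg_bot alg_top.

Lemma dual_is_dBa (D : alg) : is_dBa D -> is_dBa (dual_alg D).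
Proof.
intros hD; constructor; try apply hD.
(* The swap sends every other axiom to an axiom; this one is sent to itself with its two sides
   exchanged. *)
intros x; symmetry; apply (dba_cap_cup_id hD).
Qed.

Lemma dual_le (D : alg) (hD : is_dBa D) (x y : D) :
  @alg_le (dual_alg D) x y <-> alg_le y x.
Proof.
unfold alg_le; cbn.
rewrite (dba_cupC hD y x), (dba_capC hD y x); tauto.
Qed.

Section CupHalf.

Variables (D : alg) (hD : is_dBa D).
Implicit Types x y z : D.
Local Open Scope alg_scope.

Let hD' : is_dBa (dual_alg D) := dual_is_dBa hD.

Lemma cup_in_cup x y : in_cup (x ⊔ y).
Proof. exact (cap_in_cap hD' x y). Qed.

Lemma le_in_cup_antisym x y : in_cup x -> in_cup y -> x ⊑ y -> y ⊑ x -> x = y.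
Proof.
rewrite <- !(dual_le hD); intros hx hy le_yx le_xy.
exact (le_in_cap_antisym hD' hx hy le_xy le_yx).
Qed.

Lemma cup_lel x y : x ⊑ x ⊔ y.
Proof. apply (dual_le hD), (cap_lel hD'). Qed.

Lemma cup_ler x y : y ⊑ x ⊔ y.
Proof. apply (dual_le hD), (cap_ler hD'). Qed.

Lemma le_trans x y z : x ⊑ y -> y ⊑ z -> x ⊑ z.
Proof.
intros [e1 e2] [e3 e4]; split.
- exact (le_cap_trans hD e1 e3).
(* Duality reverses the order, so the operands are commuted and the two hypotheses are chained in
   the opposite order. *)
- rewrite (dba_cupC hD) in e2, e4 |- *.
  exact (le_cap_trans hD' e4 e2).
Qed.

Lemma le_cup2r x y z : x ⊑ y -> x ⊔ z ⊑ y ⊔ z.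
Proof. rewrite <- !(dual_le hD); apply (le_cap2r hD'). Qed.

Lemma le_cup2l x y z : x ⊑ y -> z ⊔ x ⊑ z ⊔ y.
Proof. rewrite <- !(dual_le hD); apply (le_cap2l hD'). Qed.

Lemma le_opp x y : x ⊑ y -> ⌟ y ⊑ ⌟ x.
Proof. rewrite <- !(dual_le hD); apply (le_neg hD'). Qed.

Lemma le_top x : x ⊑ ⊤.
Proof. apply (dual_le hD), (bot_le hD'). Qed.

(** Soundness of [pr_order]: the equations defining [⊑] relate values of [⊓], respectively of [⊔],
    where antisymmetry applies. *)
Lemma le_of_cap_cup x y :
  x ⊓ y ⊑ x ⊓ x -> x ⊓ x ⊑ x ⊓ y -> x ⊔ y ⊑ y ⊔ y -> y ⊔ y ⊑ x ⊔ y -> x ⊑ y.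
Proof.
intros; split.
- apply (le_in_cap_antisym hD); trivial; apply (cap_in_cap hD).
- apply le_in_cup_antisym; trivial; apply cup_in_cup.
Qed.

End CupHalf.

(** * Soundness of the axioms and rules under a fixed valuation *)

Section Soundness.

Variables (D : pdBao) (v : valuation D).

Let hD : is_dBa D := pdbao_dBa D.

Lemma biaxiom_eval (a b : form) : biaxiom a b -> eval v a = eval v b.
Proof.
intros []; cbn.
- apply (dba_negK hD).
- apply (dba_oppK hD).
- apply (dba_cap_veeD hD).
- apply (dba_cup_wedgeD hD).
- apply (dba_neg_bot hD).
- apply (dba_opp_top hD).
- symmetry; apply (dba_cap_cup_id hD).
- apply val_O_in_cap.
- apply val_P_in_cup.
- symmetry; apply pdbao_I_cap.
- symmetry; apply pdbao_C_cup.
- apply pdbao_I_neg_bot.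
- apply pdbao_C_opp_top.
- apply pdbao_I_id.
- apply pdbao_C_id.
Qed.

Lemma seq_axiom_sat (s : sequent) : seq_axiom s -> sat_sequent v s.
Proof.
intros []; cbn.
- apply le_refl.
- apply (cap_lel hD).
- apply (cap_ler hD).
- apply (cup_lel hD).
- apply (cup_ler hD).
- apply eq_le; symmetry; apply (cap_in_cap hD).
- apply eq_le, (cup_in_cup hD).
- apply eq_le, (dba_neg_cap hD).
- apply eq_le; symmetry; apply (dba_opp_cup hD).
- apply eq_le, (dba_cap_neg hD).
- apply eq_le; symmetry; apply (dba_cup_opp hD).
- apply eq_le; symmetry; apply (dba_cap_cup hD).
- apply eq_le, (dba_cup_cap hD).
- apply eq_le; symmetry; apply (dba_cap_vee hD).
- apply eq_le, (dba_cup_wedge hD).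
- apply (bot_le hD).
- apply (le_top hD).
- apply eq_le, (dba_neg_top hD).
- apply eq_le; symmetry; apply (dba_opp_bot hD).
- apply eq_le, biaxiom_eval; assumption.
- apply eq_le; symmetry; apply biaxiom_eval; assumption.
Qed.

Lemma sat_app (G H : hypersequent) : sat v (G ++ H) <-> sat v G \/ sat v H.
Proof. apply Exists_app. Qed.

Lemma sat_seq1 (s : sequent) : sat v [s] <-> sat_sequent v s.
Proof. unfold sat; rewrite Exists_cons, Exists_nil; tauto. Qed.

(** Reduces each one-premise logical rule to monotonicity or antitonicity of its connective: a
    satisfied side component survives unchanged. *)
Lemma sat_rule1 (B C : hypersequent) (s t : sequent) :
  (sat_sequent v s -> sat_sequent v t) ->
  sat v (B ++ [s] ++ C) -> sat v (B ++ [t] ++ C).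
Proof. rewrite !sat_app, !sat_seq1; tauto. Qed.

Lemma Sp_sat (a : form) : sat v [a ⊢ a ⊓ a; a ⊔ a ⊢ a]%form.
Proof.
destruct (pdbao_pure (eval v a)) as [e | e].
- apply Exists_cons_hd, eq_le; symmetry; exact e.
- apply Exists_cons_tl, Exists_cons_hd, eq_le; exact e.
Qed.

(** No rule changes the valuation, so [v] stays fixed throughout the induction and [Sigma] only has
    to hold at [v]. *)
Lemma provable_sat (Sigma : sequent -> Prop) (G : hypersequent) :
  (forall s, Sigma s -> sat v [s]) -> provable Sigma G -> sat v G.
Proof.
intros hSigma pG.
induction pG as [s hs | s hs | a | | | | | | | |
  | B C D' E a b c _ IH1 _ IH2
  | B C D' E F G H X a b _ IH1 _ IH2 _ IH3 _ IH4
  | B C D' _ IH | B C D' E _ IH | B C _ IH].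
- now apply sat_seq1, seq_axiom_sat.
- now apply hSigma.
- apply Sp_sat.
- revert IHpG; apply sat_rule1, (le_cap2r hD).
- revert IHpG; apply sat_rule1, (le_cap2l hD).
- revert IHpG; apply sat_rule1, (le_cup2r hD).
- revert IHpG; apply sat_rule1, (le_cup2l hD).
- revert IHpG; apply sat_rule1, (le_neg hD).
- revert IHpG; apply sat_rule1, (le_opp hD).
- revert IHpG; apply sat_rule1, pdbao_I_mono.
- revert IHpG; apply sat_rule1, pdbao_C_mono.
(* Either a side component of a premise is satisfied and reappears in the conclusion, or both
   principal sequents hold and transitivity applies. *)
- pose proof (@le_trans D hD (eval v a) (eval v b) (eval v c)).
  rewrite !sat_app, !sat_seq1 in *; cbn in *; tauto.
- pose proof (@le_of_cap_cup D hD (eval v a) (eval v b)).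
  rewrite !sat_app, !sat_seq1 in *; cbn in *; tauto.
(* With hypersequents read as disjunctions, the external rules are propositional tautologies. *)
- rewrite !sat_app in *; tauto.
- rewrite !sat_app in *; tauto.
- rewrite sat_app; tauto.
Qed.

End Soundness.

Theorem theorem46 (Sigma : sequent -> Prop) (G : hypersequent) :
  provable Sigma G -> valid_in (V Sigma) G.
Proof.
intros pG D hD v; apply (provable_sat (Sigma := Sigma)); trivial.
intros s hs; exact (hD s hs v).
Qed.
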